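(* For the open Borel cell $G^{e,w_0}\subset\mathrm{SL}_4(\mathbb C)$, the deep locus $\mathbb D^{\mathrm{minor}}_{e,w_0}$ obtained from the reduced-word minor charts is, on the upper unipotent quotient (i.e. up to left multiplication by diagonal matrices), $$\mathbb D^{\mathrm{minor}}_{e,w_0}=D_1'\cup D_2'\cup D_3'\cup D_4',$$ that is, $\mathbb D^{\mathrm{minor}}_{e,w_0}=\{hg: h\in H,\ g\in D_1'\cup D_2'\cup D_3'\cup D_4'\}$, where $$D_1'=\left\{\begin{pmatrix}1&0&0&u\\0&1&v&0\\0&0&1&t\\0&0&0&1\end{pmatrix}:u,v\in\mathbb C^\times,\ t\in\mathbb C\right\},\qquad D_2'=\left\{\begin{pmatrix}1&0&u&v\\0&1&0&w\\0&0&1&0\\0&0&0&1\end{pmatrix}:u,v,w\in\mathbb C^\times\right\},$$ $$D_3'=\left\{\begin{pmatrix}1&u&0&uvw\\0&1&v&vw\\0&0&1&w\\0&0&0&1\end{pmatrix}:u,v,w\in\mathbb C^\times\right\},\qquad D_4'=\left\{\begin{pmatrix}1&t&tv&u\\0&1&v&0\\0&0&1&0\\0&0&0&1\end{pmatrix}:u,v\in\mathbb C^\times,\ t\in\mathbb C\right\}.$$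
   Context: $B$ (resp. $B^-$) is the subgroup of upper (resp. lower) triangular matrices in $\mathrm{SL}_4(\mathbb C)$, $H$ the diagonal matrices in $\mathrm{SL}_4(\mathbb C)$, $w_0\in S_4$ the longest element, $s_i=(i,i+1)$, and $G^{e,w_0}=B\cap B^-\dot w_0B^-$. Every element of $B$ is uniquely $hg$ with $h\in H$ and $g$ upper unitriangular. $\Delta_{I,J}(M)$ denotes the minor of $M$ with row set $I$ and column set $J$ (both in increasing order); $[1,i]=\{1,\dots,i\}$. $G^{e,w_0}$ is the open subset of $B$ where $\Delta_{1,4}\ne0$, $\Delta_{12,34}\neq0$, $\Delta_{123,234}\neq0$. For a reduced word $\mathbf i=(i_1,\dots,i_6)$ of $w_0$ put $v_{<k}=s_{i_1}\cdots s_{i_{k-1}}$. Its minor variables are $\Delta_{[1,i_k],\,v_{<k}[1,i_k]}$ for $1\le k\le6$ together with the frozen minors $\Delta_{[1,j],\,w_0[1,j]}$, $j=1,2,3$. The minor chart of $\mathbf i$ is the set of points of $G^{e,w_0}$ where all of these minors are non-zero. $\mathbb D^{\mathrm{minor}}_{e,w_0}$ is the complement in $G^{e,w_0}$ of the union of the minor charts over all reduced words $\mathbf i$ of $w_0$. (Explicitly, besides minors that never vanish on the cell, the minors occurring in the charts are $A=\Delta_{1,2}$, $B=\Delta_{1,3}$, $C=\Delta_{12,23}$, $D=\Delta_{12,13}$, $E=\Delta_{123,134}$, $F=\Delta_{12,14}$, $G=\Delta_{123,124}$, $H=\Delta_{12,24}$, in the eight triples $ABC$, $BCD$, $CDE$,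 $DEF$, $EFG$, $FGH$, $AGH$, $ACH$; here the letters $B,G,H$ denote minors.) *)

(* Defs.v *)
From HB Require Import structures.
From mathcomp Require Import all_boot all_order all_algebra all_fingroup.
From mathcomp Require Import complex.
From mathcomp Require Import classical_sets reals.

Set Implicit Arguments.
Unset Strict Implicit.
Unset Printing Implicit Defensive.

Import GRing.Theory.

Local Open Scope ring_scope.
Local Open Scope classical_set_scope.

(* All indices are 0-based: 'I_4 stands for {1,2,3,4} and 'I_3 for {1,2,3}. *)

Section Weyl.

Definition simple_refl (i : 'I_3) : 'S_4 :=
  tperm (widen_ord (leqnSn 3) i) (lift ord0 i).

(* The permutation s_{i_1} o s_{i_2} o ... o s_{i_l} (the rightmost factor acts
   first). The product of 'S_4 composes in the opposite order, hence rev. *)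
Definition word_perm (s : seq 'I_3) : 'S_4 :=
  (\prod_(i <- rev s) simple_refl i)%g.

Definition reduced_word (w : 'S_4) (s : seq 'I_3) : Prop :=
  word_perm s = w /\
  forall s' : seq 'I_3, word_perm s' = w -> (size s <= size s')%N.

Definition w0 : 'S_4 := perm (@rev_ord_inj 4).

(* [1, i + 1] for the 0-based index i. *)
Definition initial (i : 'I_3) : {set 'I_4} := [set x : 'I_4 | (x <= i)%N].

End Weyl.

Section Cell.
Variable F : fieldType.

(* enum lists a set of ordinals increasingly; only meaningful if #|I| = #|J|. *)
Definition minor (I J : {set 'I_4}) (M : 'M[F]_4) : F :=
  \det (\matrix_(a < #|I|, b < #|I|)
          M (nth ord0 (enum I) a) (nth ord0 (enum J) b)).

Definition SL4 : set 'M[F]_4 := [set M | \det M = 1].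

Definition torus : set 'M[F]_4 := [set M | SL4 M /\ is_diag_mx M].

Definition borel_lower : set 'M[F]_4 := [set M | SL4 M /\ is_trig_mx M].

Definition borel_upper : set 'M[F]_4 := [set M | SL4 M /\ is_trig_mx M^T].

(* w0 is an even permutation, so its permutation matrix lies in SL_4. Any other
   lift of w0 differs by an element of the torus, which does not change the
   double coset below. *)
Definition w0_lift : 'M[F]_4 := perm_mx w0.

Definition open_cell : set 'M[F]_4 :=
  borel_upper `&`
  [set M | exists b1 b2 : 'M[F]_4,
     [/\ borel_lower b1, borel_lower b2 & M = b1 *m w0_lift *m b2]].

Definition minor_chart (s : 6.-tuple 'I_3) : set 'M[F]_4 :=
  [set M | [/\ open_cell M,
    (forall k : 'I_6,
       minor (initial (tnth s k))
             (word_perm (take k s) @: initial (tnth s k))%SET M != 0)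
    & (forall j : 'I_3, minor (initial j) (w0 @: initial j)%SET M != 0)]].

Definition minor_deep_locus : set 'M[F]_4 :=
  open_cell `\`
  \bigcup_(s in [set s : 6.-tuple 'I_3 | reduced_word w0 s]) minor_chart s.

Definition mx4 (rows : seq (seq F)) : 'M[F]_4 :=
  \matrix_(i < 4, j < 4) nth 0 (nth [::] rows i) j.

Definition D1' : set 'M[F]_4 :=
  [set g | exists u v t : F, [/\ u != 0, v != 0 & g = mx4
    [:: [:: 1; 0; 0; u];
        [:: 0; 1; v; 0];
        [:: 0; 0; 1; t];
        [:: 0; 0; 0; 1]]]].

Definition D2' : set 'M[F]_4 :=
  [set g | exists u v w : F, [/\ u != 0, v != 0, w != 0 & g = mx4
    [:: [:: 1; 0; u; v];
        [:: 0; 1; 0; w];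
        [:: 0; 0; 1; 0];
        [:: 0; 0; 0; 1]]]].

Definition D3' : set 'M[F]_4 :=
  [set g | exists u v w : F, [/\ u != 0, v != 0, w != 0 & g = mx4
    [:: [:: 1; u; 0; u * v * w];
        [:: 0; 1; v; v * w];
        [:: 0; 0; 1; w];
        [:: 0; 0; 0; 1]]]].

Definition D4' : set 'M[F]_4 :=
  [set g | exists u v t : F, [/\ u != 0, v != 0 & g = mx4
    [:: [:: 1; t; t * v; u];
        [:: 0; 1; v; 0];
        [:: 0; 0; 1; 0];
        [:: 0; 0; 0; 1]]]].

End Cell.

(* Main.v *)
Require Import Defs.
From mathcomp Require Import all_boot all_order all_algebra all_fingroup.
From mathcomp Require Import complex ring.
From mathcomp Require Import classical_sets reals.

(** The question is invariant under left multiplication by the torus, which only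
    rescales the minors with row set [1, i]; so one may take a unitriangular
    matrix with entries x, y, z, p, q, r above the diagonal, read row by row
    ([borel_upper_factor], [flag_minor_torus]).  It lies in the open cell
    exactly when its three frozen minors are non-zero: one direction is the
    Cauchy-Binet formula for lower * w0 * lower ([flag_minor_cell]), the other is
    an explicit LU decomposition whose pivots are ratios of successive frozen
    minors ([open_cell_unip]).

    The charts are then a finite matter.  With

      A = Delta_{1,2} = x             B = Delta_{1,3} = y
      C = Delta_{12,23} = x p - y     D = Delta_{12,13} = p
      E = Delta_{123,134} = p r - q   F = Delta_{12,14} = q
      G = Delta_{123,124} = r         H = Delta_{12,24} = x q - z

    the sixteen reduced words of w0 produce, besides the frozen minors and the
    minors Delta_{[1,i],[1,i]} = 1, exactly the triples ABC, BCD, BDE, DEF, EFG,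
    FGH, AGH, ACH (a computation over all words of length 6).  Hence a point of
    the cell is deep iff each of these triples contains a vanishing minor
    ([deep_unipP]).

    It remains to solve that system ([deep_unip_families]).  The relations
    between the minors leave four ways of hitting all the triples, governed by
    the triple ACH:
      - A = B = 0 forces C = 0, then F = 0: the family D1';
      - A = 0, B != 0 forces D = G = 0: the family D2';
      - A != 0, C = 0 turns Delta_{12,34} into D H, so G = 0, then F = 0:
        the family D4';
      - A, C != 0 forces H = B = 0, then E = 0: the family D3'.
    Conversely the vanishing sets ABCF, ADG, BEH, CEFG of these families meet
    every triple ([families_deep_unip]). *)

Set Implicit Arguments.
Unset Strict Implicit.
Unset Printing Implicit Defensive.

Import GRing.Theory.

Local Open Scope ring_scope.

(** * Reduced words of the longest element *)

(** Words and permutations are mirrored by lists and functions of natural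
    numbers, so that statements about all words of a given length can be decided
    by evaluation. *)
Definition swap (i x : nat) : nat :=
  if x == i then i.+1 else if x == i.+1 then i else x.

Definition word_fun (s : seq nat) (x : nat) : nat := foldr swap x s.

Definition is_w0_word (s : seq nat) : bool :=
  [seq word_fun s x | x <- iota 0 4] == [:: 3; 2; 1; 0]%N.

(** The increasing order matches the convention for the columns of a minor. *)
Definition image_cols (f : nat -> nat) (i : nat) : seq nat :=
  [seq x <- iota 0 4 | x \in [seq f y | y <- iota 0 i.+1]].

(** Column sets of the minor variables of a word; the row set of each is the
    initial interval of the same size. *)
Definition chart_cols (s : seq nat) : seq (seq nat) :=
  [seq image_cols (word_fun (take k s)) (nth 0%N s k) | k <- iota 0 6].

Definition words (n : nat) : seq (seq nat) :=
  iter n (fun ws => [seq i :: w | i <- iota 0 3, w <- ws]) [:: [::]].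

Lemma mem_words (s : seq nat) :
  all (fun i => i < 3)%N s -> s \in words (size s).
Proof.
elim: s => // i s IHs /andP[lt_i3 lt_s3].
by apply/allpairsP; exists (i, s); rewrite (IHs lt_s3) mem_iota lt_i3.
Qed.

Lemma mem_words_ord (s : seq 'I_3) : map val s \in words (size s).
Proof.
by rewrite -(size_map val); apply/mem_words/allP => _ /mapP[i _ ->] /=.
Qed.

Lemma words_size n s : s \in words n -> size s = n /\ all (fun i => i < 3)%N s.
Proof.
elim: n s => [|n IHn] s; first by rewrite inE => /eqP ->.
case/allpairsP=> -[i w] [i3 /IHn[<- w3] ->].
by move: i3; rewrite mem_iota /= => ->.
Qed.

Lemma words_tuple n s : s \in words n -> exists t : n.-tuple 'I_3, map val t = s.
Proof.
case/words_size => Es /allP s3.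
have sz : size (map (@inord 2) s) == n by rewrite size_map Es.
exists (Tuple sz); rewrite /= -map_comp -[RHS]map_id.
by apply/eq_in_map => i /s3 /= /inordK.
Qed.

Lemma val_simple_refl (i : 'I_3) (x : 'I_4) :
  simple_refl i x = swap i x :> nat.
Proof.
rewrite /simple_refl permE /= /swap.
rewrite -!(inj_eq val_inj) /=.
by rewrite /bump /= add1n; case: ifP => // _; case: ifP.
Qed.

Lemma val_word_perm (s : seq 'I_3) (x : 'I_4) :
  word_perm s x = word_fun (map val s) x :> nat.
Proof.
rewrite /word_perm; elim: s x => [|i s IHs] x /=; first by rewrite big_nil perm1.
by rewrite rev_cons -cats1 big_cat /= big_seq1 permM val_simple_refl IHs.
Qed.

Lemma word_perm_w0P (s : seq 'I_3) :
  reflect (word_perm s = w0) (is_w0_word (map val s)).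
Proof.
apply: (iffP eqP) => [Es | Es].
  apply/permP => x; apply: val_inj; rewrite /= val_word_perm permE /=.
  have := congr1 (fun t => nth 0%N t x) Es.
  by rewrite (nth_map 0%N) ?size_iota // nth_iota //= add0n => ->;
     case: x => [[|[|[|[|]]]]].
have E x : word_fun (map val s) (x : 'I_4) = (3 - x)%N.
  by rewrite -val_word_perm Es permE /= subSS.
rewrite -[iota 0 4](val_enum_ord 4) -map_comp.
by rewrite (eq_map E) (map_comp (subn 3) val) val_enum_ord.
Qed.

Lemma short_words_not_w0 :
  all (fun n => all (predC is_w0_word) (words n)) (iota 0 6).
Proof. by vm_compute. Qed.

(** Since no word of length less than 6 represents w0, being reduced amounts for
    a word of length 6 to representing w0. *)
Lemma reduced_word_w0P (s : 6.-tuple 'I_3) :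
  reflect (reduced_word w0 s) (is_w0_word (map val s)).
Proof.
apply: (iffP (word_perm_w0P s)) => [Es | [] //]; split=> // s' /word_perm_w0P.
rewrite size_tuple leqNgt; apply: contraTN => lt_s'6.
have /allP/(_ (size s')) := short_words_not_w0.
by rewrite mem_iota => /(_ lt_s'6) /allP/(_ _ (mem_words_ord s')).
Qed.

(** * The eight triples of minors *)

Definition frozen_cols : seq (seq nat) := [:: [:: 3]; [:: 2; 3]; [:: 1; 2; 3]]%N.

(** Column sets of the minors that are identically 1 on unitriangular
    matrices. *)
Definition flag_cols : seq (seq nat) := [:: [:: 0]; [:: 0; 1]; [:: 0; 1; 2]]%N.

Definition chart_triples : seq (seq (seq nat)) :=
  let A := [:: 1] in let B := [:: 2] in let C := [:: 1; 2] in
  let D := [:: 0; 2] in let E := [:: 0; 2; 3] in let F := [:: 0; 3] in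
  let G := [:: 0; 1; 3] in let H := [:: 1; 3] in
  [:: [:: A; B; C]; [:: B; C; D]; [:: B; D; E]; [:: D; E; F];
      [:: E; F; G]; [:: F; G; H]; [:: A; G; H]; [:: A; C; H]]%N.

(** The minor variables of s are those of T, up to minors that do not vanish on
    the unitriangular part of the cell. *)
Definition is_chart_triple (s : seq nat) (T : seq (seq nat)) : bool :=
  [&& is_w0_word s, all [in chart_cols s] T
    & all [in T ++ flag_cols ++ frozen_cols] (chart_cols s)].

Lemma chart_triples_sound :
  all (fun s => is_w0_word s ==> has (is_chart_triple s) chart_triples) (words 6).
Proof. by vm_compute. Qed.

Lemma chart_triples_complete :
  all (fun T => has (is_chart_triple^~ T) (words 6)) chart_triples.
Proof. by vm_compute. Qed.

(** * Minors with initial row sets *)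

Section Minors.
Variable F : fieldType.
Implicit Types (M g h : 'M[F]_4) (L : seq nat).

(** The minor Delta_{[1,k],L} for a list L of k columns: the row set is implied by
    L, and L is a list of numbers that evaluation can produce. *)
Definition flag_minor L M : F :=
  \det (\matrix_(a < size L, b < size L) M (inord a) (inord (nth 0%N L b))).

Lemma minor_enum (I J : {set 'I_4}) M :
  minor I J M =
  \det (\matrix_(a < #|I|, b < #|I|)
          M (inord (nth 0%N (map val (enum I)) a))
            (inord (nth 0%N (map val (enum J)) b))).
Proof.
have nthE (K : {set 'I_4}) (a : nat) :
    nth ord0 (enum K) a = inord (nth 0%N (map val (enum K)) a).
  have [lt_a | ge_a] := ltnP a (size (enum K)).
    by rewrite (nth_map ord0) // inord_val.
  by rewrite !nth_default ?size_map //; apply: val_inj; rewrite /= inordK.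
by congr (\det _); apply/matrixP => a b; rewrite !mxE !nthE.
Qed.

(** Cutting the enumeration of the column set out of [iota 0 4] makes it
    computable from any function on nat that agrees with the permutation. *)
Lemma val_enum_set (A : {set 'I_4}) (p : pred nat) :
  (forall x : 'I_4, (x \in A) = p x) -> map val (enum A) = filter p (iota 0 4).
Proof.
move=> Ap; rewrite -val_enum_ord filter_map; congr map.
by rewrite {1}/enum_mem -enumT; apply: eq_filter => x; rewrite inE Ap.
Qed.

Lemma initial_cols (i : 'I_3) : map val (enum (initial i)) = iota 0 i.+1.
Proof.
rewrite (@val_enum_set _ (fun x => x <= i)%N) => [|x]; last by rewrite inE.
by case: i => [[|[|[|]]]].
Qed.

Lemma card_initial (i : 'I_3) : #|initial i| = i.+1.
Proof. by rewrite cardE -(size_map val) initial_cols size_iota. Qed.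

Lemma image_initial_cols (w : 'S_4) (f : nat -> nat) (i : 'I_3) :
  (forall x : 'I_4, w x = f x :> nat) ->
  map val (enum (w @: initial i)%SET) = image_cols f i.
Proof.
move=> wE; apply: val_enum_set => x; rewrite -initial_cols -map_comp.
rewrite -(@eq_map _ _ (val \o w)) => [|y]; last exact: wE.
rewrite map_comp (mem_map val_inj).
by apply/imsetP/mapP => -[y yi ->]; exists y; rewrite ?mem_enum // -mem_enum.
Qed.

Lemma minor_initial (w : 'S_4) (f : nat -> nat) (i : 'I_3) M :
  (forall x : 'I_4, w x = f x :> nat) ->
  minor (initial i) (w @: initial i)%SET M = flag_minor (image_cols f i) M.
Proof.
move=> wE; have sz : size (image_cols f i) = i.+1.
  rewrite -(image_initial_cols i wE) size_map -cardE card_imset ?card_initial //.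
  exact: perm_inj.
rewrite minor_enum (image_initial_cols i wE) initial_cols /flag_minor.
rewrite card_initial sz; congr (\det _); apply/matrixP => a b.
by rewrite !mxE nth_iota.
Qed.

Lemma minor_chartP (s : 6.-tuple 'I_3) M :
  minor_chart s M <->
  [/\ open_cell M,
      all (fun L => flag_minor L M != 0) (chart_cols (map val s))
    & all (fun L => flag_minor L M != 0) frozen_cols].
Proof.
have chartE (k : 'I_6) :
    minor (initial (tnth s k)) (word_perm (take k s) @: initial (tnth s k))%SET M
    = flag_minor (nth [::] (chart_cols (map val s)) k) M.
  rewrite (minor_initial (f := word_fun (map val (take k s)))); last first.
    exact: val_word_perm.
  rewrite /chart_cols (nth_map 0%N) ?size_iota // nth_iota // add0n map_take.
  by rewrite (nth_map (tnth s k)) ?size_tuple // -tnth_nth.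
have frozenE (j : 'I_3) :
    minor (initial j) (w0 @: initial j)%SET M
    = flag_minor (nth [::] frozen_cols j) M.
  rewrite (minor_initial (f := subn 3)); last by move=> x; rewrite permE /= subSS.
  by case: j => [[|[|[|]]]].
split=> -[cellM chM frM]; split=> //.
- apply/(all_nthP [::]) => k; rewrite size_map size_iota => lt_k6.
  by rewrite -[k]/(val (Ordinal lt_k6)) -chartE.
- apply/(all_nthP [::]) => k lt_k3.
  by rewrite -[k]/(val (Ordinal lt_k3)) -frozenE.
- move=> k; rewrite chartE; apply: (all_nthP [::] chM).
  by rewrite size_map size_iota.
- by move=> j; rewrite frozenE; apply: (all_nthP [::] frM).
Qed.

(** * Explicit 4 x 4 matrices *)

Definition mx_unip (x y z p q r : F) : 'M[F]_4 := mx4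
  [:: [:: 1; x; y; z]; [:: 0; 1; p; q]; [:: 0; 0; 1; r]; [:: 0; 0; 0; 1]].

Lemma det_mx2 (f : nat -> nat -> F) :
  \det (\matrix_(a < 2, b < 2) f a b) =
    f 0%N 0%N * f 1%N 1%N - f 0%N 1%N * f 1%N 0%N.
Proof.
rewrite (expand_det_row _ 0) !big_ord_recl big_ord0 /cofactor !det_mx11 !mxE /=.
by rewrite /bump /=; ring.
Qed.

Lemma det_mx3 (f : nat -> nat -> F) :
  \det (\matrix_(a < 3, b < 3) f a b) =
    f 0%N 0%N * (f 1%N 1%N * f 2%N 2%N - f 1%N 2%N * f 2%N 1%N)
  - f 0%N 1%N * (f 1%N 0%N * f 2%N 2%N - f 1%N 2%N * f 2%N 0%N)
  + f 0%N 2%N * (f 1%N 0%N * f 2%N 1%N - f 1%N 1%N * f 2%N 0%N).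
Proof.
rewrite (expand_det_row _ 0) !big_ord_recl big_ord0 /cofactor.
rewrite !(expand_det_row _ 0) !big_ord_recl !big_ord0 /cofactor !det_mx11 !mxE /=.
by rewrite /bump /=; ring.
Qed.

Lemma flag_minor1 (j : nat) M : flag_minor [:: j] M = M (inord 0) (inord j).
Proof. by rewrite /flag_minor det_mx11 mxE. Qed.

Lemma flag_minor2 (j k : nat) M : flag_minor [:: j; k] M =
    M (inord 0) (inord j) * M (inord 1) (inord k)
  - M (inord 0) (inord k) * M (inord 1) (inord j).
Proof.
exact: (det_mx2 (fun a b => M (inord a) (inord (nth 0%N [:: j; k] b)))).
Qed.

Lemma flag_minor3 (j k l : nat) M :
  let m (a b : nat) := M (inord a) (inord b) in
  flag_minor [:: j; k; l] M =
    m 0%N j * (m 1%N k * m 2%N l - m 1%N l * m 2%N k)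
  - m 0%N k * (m 1%N j * m 2%N l - m 1%N l * m 2%N j)
  + m 0%N l * (m 1%N j * m 2%N k - m 1%N k * m 2%N j).
Proof.
exact: (det_mx3 (fun a b => M (inord a) (inord (nth 0%N [:: j; k; l] b)))).
Qed.

Lemma mx4E (rows : seq (seq F)) i j : (i < 4)%N -> (j < 4)%N ->
  mx4 rows (inord i) (inord j) = nth 0 (nth [::] rows i) j.
Proof. by move=> lt_i4 lt_j4; rewrite mxE !inordK. Qed.

Lemma mulmx4E M N (i j : 'I_4) : (M *m N) i j =
  M i (inord 0) * N (inord 0) j + M i (inord 1) * N (inord 1) j
  + M i (inord 2) * N (inord 2) j + M i (inord 3) * N (inord 3) j.
Proof.
rewrite mxE (eq_bigr (fun k : 'I_4 => M i (inord k) * N (inord k) j)) => [|k _].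
  2: by rewrite inord_val.
rewrite -(big_mkord xpredT (fun k => M i (inord k) * N (inord k) j)).
by do 4!rewrite big_ltn //; rewrite big_geq // addr0 -!addrA.
Qed.

Lemma mx4_eqP (M N : 'M[F]_4) :
  (forall i j : nat, (i < 4)%N -> (j < 4)%N ->
     M (inord i : 'I_4) (inord j : 'I_4) = N (inord i) (inord j)) ->
  M = N.
Proof.
by move=> eqMN; apply/matrixP => i j; rewrite -(inord_val i) -(inord_val j) eqMN.
Qed.

Lemma flag_minor_unip x y z p q r :
  let m := flag_minor^~ (mx_unip x y z p q r) in
  [/\ [/\ m [:: 0]%N = 1, m [:: 1]%N = x, m [:: 2]%N = y & m [:: 3]%N = z],
      [/\ m [:: 0; 1]%N = 1, m [:: 0; 2]%N = p & m [:: 0; 3]%N = q],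
      [/\ m [:: 1; 2]%N = x * p - y, m [:: 1; 3]%N = x * q - z
        & m [:: 2; 3]%N = y * q - z * p]
    & [/\ m [:: 0; 1; 2]%N = 1, m [:: 0; 1; 3]%N = r,
          m [:: 0; 2; 3]%N = p * r - q
        & m [:: 1; 2; 3]%N = x * (p * r - q) - (y * r - z)]].
Proof.
by rewrite /= !(flag_minor1, flag_minor2, flag_minor3) !mx4E //=; do !split; ring.
Qed.

(** * Torus invariance and the open cell *)

(** Left multiplication by diag(d) multiplies the minor with rows [1, k] by
    d_1 ... d_k, which is a unit. *)
Lemma flag_minor_torus h M L : torus h ->
  (flag_minor L (h *m M) != 0) = (flag_minor L M != 0).
Proof.
case=> det_h /diag_mxP[d Eh].
have d_neq0 k : d 0 k != 0.
  move: det_h; rewrite /SL4 /= Eh det_diag => det_h.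
  have /prodf_neq0 dn0 : \prod_k d 0 k != 0 by rewrite det_h oner_neq0.
  exact: dn0.
have -> : flag_minor L (h *m M)
    = \det (diag_mx (\row_(a < size L) d 0 (inord a))) * flag_minor L M.
  rewrite -det_mulmx; congr (\det _); apply/matrixP => a b.
  by rewrite Eh !mul_diag_mx !mxE.
rewrite det_diag mulf_eq0 negb_or andb_idl // => _.
by apply/prodf_neq0 => a _; rewrite mxE.
Qed.

Lemma trig_mx4_eta M :
  is_trig_mx M ->
  M = mx4 [:: [:: M (inord 0) (inord 0); 0; 0; 0];
              [:: M (inord 1) (inord 0); M (inord 1) (inord 1); 0; 0];
              [:: M (inord 2) (inord 0); M (inord 2) (inord 1);
                  M (inord 2) (inord 2); 0];
              [:: M (inord 3) (inord 0); M (inord 3) (inord 1);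
                  M (inord 3) (inord 2); M (inord 3) (inord 3)]].
Proof.
move=> /is_trig_mxP trM; apply: mx4_eqP => i j lt_i4 lt_j4; rewrite mx4E //.
case: i j lt_i4 lt_j4 => [|[|[|[|]]]] // [|[|[|[|]]]] //= _ _.
all: by apply: trM; rewrite !inordK.
Qed.

Lemma is_trig_mx4 (a b c d e f g h i j : F) :
  is_trig_mx (mx4 [:: [:: a; 0; 0; 0]; [:: b; c; 0; 0];
                      [:: d; e; f; 0]; [:: g; h; i; j]]).
Proof.
apply/is_trig_mxP => i' j'; rewrite mxE.
by case: i' j' => [[|[|[|[|?]]]] ?] // [[|[|[|[|?]]]] ?].
Qed.

Lemma det_trig4 M : is_trig_mx M ->
  \det M = M (inord 0) (inord 0) * M (inord 1) (inord 1)
         * M (inord 2) (inord 2) * M (inord 3) (inord 3).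
Proof.
move/det_trig ->.
rewrite (eq_bigr (fun k : 'I_4 => M (inord k) (inord k))) => [|k _].
  2: by rewrite inord_val.
rewrite -(big_mkord xpredT (fun k : nat => M (inord k) (inord k))).
by do 4!rewrite big_ltn //; rewrite big_geq // mulr1 !mulrA.
Qed.

Lemma unip_upper x y z p q r : is_trig_mx (mx_unip x y z p q r)^T.
Proof.
apply/is_trig_mxP => i j; rewrite !mxE.
by case: i j => [[|[|[|[|?]]]] ?] // [[|[|[|[|?]]]] ?].
Qed.

Lemma det_unip x y z p q r : \det (mx_unip x y z p q r) = 1.
Proof.
by rewrite -det_tr det_trig4 ?unip_upper // !mxE !inordK //= !mulr1.
Qed.

Lemma borel_upper_factor M : borel_upper M ->
  exists h x y z p q r, torus h /\ M = h *m mx_unip x y z p q r.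
Proof.
case=> detM trM; have := detM; rewrite /SL4 /= -det_tr det_trig4 // !mxE => prod1.
move: (trM) => /trig_mx4_eta/(congr1 trmx); rewrite trmxK !mxE => EM.
have: M (inord 0) (inord 0) * M (inord 1) (inord 1)
         * M (inord 2) (inord 2) * M (inord 3) (inord 3) != 0.
  by rewrite prod1 oner_neq0.
rewrite !mulf_eq0 !negb_or -!andbA => /and4P[n0 n1 n2 n3].
exists (diag_mx (\row_a M a a)).
exists (M (inord 0) (inord 1) / M (inord 0) (inord 0)).
exists (M (inord 0) (inord 2) / M (inord 0) (inord 0)).
exists (M (inord 0) (inord 3) / M (inord 0) (inord 0)).
exists (M (inord 1) (inord 2) / M (inord 1) (inord 1)).
exists (M (inord 1) (inord 3) / M (inord 1) (inord 1)).
exists (M (inord 2) (inord 3) / M (inord 2) (inord 2)).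
split.
  split; last exact: diag_mx_is_diag.
  by rewrite /SL4 /= det_trig4 ?diag_mx_is_trig // !mxE !eqxx !mulr1n.
rewrite mul_diag_mx; apply: mx4_eqP => i j lt_i4 lt_j4.
rewrite [LHS](congr1 (fun N : 'M_4 => N (inord i) (inord j)) EM) !mxE !inordK //.
case: i j lt_i4 lt_j4 => [|[|[|[|]]]] // [|[|[|[|]]]] //= _ _.
all: by rewrite ?mulr0 ?mulr1 // mulrCA divff ?mulr1.
Qed.

Lemma w0_liftE M (i : nat) j : (i < 4)%N ->
  (w0_lift F *m M) (inord i) j = M (inord (3 - i)) j.
Proof.
move=> lt_i4; rewrite /w0_lift -row_permE mxE; congr (M _ j).
by rewrite permE; apply: val_inj; rewrite /= !inordK ?subSS // ltnS leq_subr.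
Qed.

(** The first k rows of b involve only its first k columns and the last k columns
    of c only its last k rows, so the minor splits as the product of two
    triangular determinants, up to the sign of the reversal. *)
Lemma flag_minor_cell b c : is_trig_mx b -> is_trig_mx c ->
  let M := b *m w0_lift F *m c in
  let b_ (i : nat) := b (inord i) (inord i) in
  let c_ (i : nat) := c (inord i) (inord i) in
  [/\ flag_minor [:: 3]%N M = b_ 0%N * c_ 3,
      flag_minor [:: 2; 3]%N M = - (b_ 0%N * b_ 1%N * (c_ 2 * c_ 3))
    & flag_minor [:: 1; 2; 3]%N M
      = - (b_ 0%N * b_ 1%N * b_ 2 * (c_ 1%N * c_ 2 * c_ 3))].
Proof.
move=> tr_b tr_c /=; rewrite (trig_mx4_eta tr_b) (trig_mx4_eta tr_c) -mulmxA.
rewrite flag_minor1 flag_minor2 flag_minor3 !(mulmx4E _ (_ *m _)).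
rewrite !w0_liftE // !subSS !subn0.
by rewrite !mx4E //=; split; ring.
Qed.

Lemma open_cell_frozen M :
  open_cell M -> all (fun L => flag_minor L M != 0) frozen_cols.
Proof.
case=> _ [b [c [[det_b tr_b] [det_c tr_c] ->]]].
have: \det b * \det c != 0 by rewrite det_b det_c mulr1 oner_neq0.
rewrite !det_trig4 // !mulf_eq0 !negb_or -!andbA.
case/and5P=> b0 b1 b2 b3 /and4P[c0 c1 c2 c3].
have [/= -> -> ->] := flag_minor_cell tr_b tr_c.
by rewrite !oppr_eq0 !mulf_eq0 !negb_or b0 b1 b2 c1 c2 c3.
Qed.

(** Gaussian elimination on the matrix with its columns reversed: its leading
    principal minors are, up to sign, the frozen minors, so no pivot vanishes.
    The lower unitriangular factor can be written down. *)
Lemma open_cell_unip x y z p q r :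
  all (fun L => flag_minor L (mx_unip x y z p q r) != 0) frozen_cols ->
  open_cell (mx_unip x y z p q r).
Proof.
have [[_ _ _ m3] _ [_ _ m23] [_ _ _ m123]] := flag_minor_unip x y z p q r.
rewrite /= m3 m23 m123 andbT => /and3P[z0 p20 p30].
split; first by split; [exact: det_unip | exact: unip_upper].
set p2 := y * q - z * p in m23 p20; set p3 := x * _ - _ in m123 p30.
exists (mx4 [:: [:: 1; 0; 0; 0]; [:: q / z; 1; 0; 0];
                [:: r / z; (y * r - z) / p2; 1; 0];
                [:: z^-1; y / p2; (x * p - y) / p3; 1]]).
exists (mx4 [:: [:: - p3^-1; 0; 0; 0]; [:: (p * r - q) / p2; p3 / p2; 0; 0];
                [:: - q / z; (z - x * q) / z; - p2 / z; 0]; [:: 1; x; y; z]]).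
split.
- split; last exact: is_trig_mx4.
  by rewrite /SL4 /= det_trig4 ?is_trig_mx4 // !mx4E //= !mulr1.
- split; last exact: is_trig_mx4.
  rewrite /SL4 /= det_trig4 ?is_trig_mx4 // !mx4E //=; field.
  by rewrite z0 p20.
apply: mx4_eqP => i j lt_i4 lt_j4.
rewrite -mulmxA !(mulmx4E _ (_ *m _)) !w0_liftE // !subSS !subn0 !mx4E //.
case: i j lt_i4 lt_j4 => [|[|[|[|?]]]] // [|[|[|[|?]]]] //= _ _.
all: rewrite ?mul1r ?mul0r ?add0r ?addr0 ?mulr0 ?mulr1 //.
all: try (rewrite /p3 /p2; field; rewrite -/p2 -/p3 ?z0 ?p20 ?p30 //).
Qed.

Lemma open_cell_torus h M : torus h -> open_cell M -> open_cell (h *m M).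
Proof.
case=> det_h diag_h [[det_M tr_M] [b [c [[det_b tr_b] cL EM]]]].
have /diag_mxP[d Eh] := diag_h.
have SLh N : SL4 N -> SL4 (h *m N) by rewrite /SL4 /= det_mulmx det_h mul1r.
split.
  split; [exact: SLh | apply/is_trig_mxP => i j lt_ij].
  have /= := is_trig_mxP tr_M i j lt_ij.
  by rewrite Eh mul_diag_mx !mxE => ->; rewrite mulr0.
exists (h *m b), c; split; rewrite ?EM ?mulmxA //; split; first exact: SLh.
apply/is_trig_mxP => i j lt_ij; rewrite Eh mul_diag_mx mxE.
by rewrite (is_trig_mxP tr_b) ?mulr0.
Qed.

(** * The deep locus in terms of the triples *)

Definition deep_unip M : Prop :=
  all (fun L => flag_minor L M != 0) frozen_cols
  /\ all (has (fun L => flag_minor L M == 0)) chart_triples.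

(** Every chart is contained in the non-vanishing locus of some triple and every
    such locus is realised by a chart, because the remaining minor variables are
    units on the cell. *)
Lemma deep_unipP h x y z p q r (u := mx_unip x y z p q r) : torus h ->
  minor_deep_locus (h *m u) <-> deep_unip u.
Proof.
move=> torh; have minorE L := flag_minor_torus u L torh.
split=> [[cell deep] | [fr tri]].
  have fr : all (fun L => flag_minor L u != 0) frozen_cols.
    by rewrite -(eq_all minorE) open_cell_frozen.
  split=> //; apply/allP => T tT; apply: contra_notT deep.
  rewrite -all_predC => Tneq0.
  have /hasP[s s6 /and3P[w0s _ /allP sT]] := allP chart_triples_complete T tT.
  have [t Et] := words_tuple s6.
  exists t; first by apply/reduced_word_w0P; rewrite Et.
  apply/minor_chartP; rewrite Et; split=> //; last by rewrite (eq_all minorE).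
  rewrite (eq_all minorE); apply/allP => L /sT LT.
  have: L \in T ++ flag_cols ++ frozen_cols by [].
  rewrite !mem_cat => /or3P[Lt | | Lfr].
  - exact: (allP Tneq0 L Lt).
  - have [[m1 _ _ _] [m12 _ _] _ [m123 _ _ _]] := flag_minor_unip x y z p q r.
    by rewrite !inE -/u => /or3P[] /eqP ->; rewrite ?(m1, m12, m123) oner_neq0.
  - exact: (allP fr L Lfr).
split; first exact/open_cell_torus/open_cell_unip.
case=> t /reduced_word_w0P w0t /minor_chartP[_ chart _].
have := mem_words_ord t; rewrite size_tuple => /(allP chart_triples_sound).
rewrite w0t => /hasP[T tT /and3P[_ /allP Tt _]].
have /hasP[L /Tt Lt /eqP Leq0] := allP tri T tT.
by have := allP chart L Lt; rewrite minorE Leq0 eqxx.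
Qed.

(** * Solving the vanishing conditions *)

Lemma frozen_unipE x y z p q r :
  all (fun L => flag_minor L (mx_unip x y z p q r) != 0) frozen_cols
  = [&& z != 0, y * q - z * p != 0 & x * (p * r - q) - (y * r - z) != 0].
Proof.
have [[_ _ _ m3] _ [_ _ m23] [_ _ _ m123]] := flag_minor_unip x y z p q r.
by rewrite /= m3 m23 m123 andbT.
Qed.

Lemma triples_unipE x y z p q r :
  let A := x == 0 in let B := y == 0 in let C := x * p - y == 0 in
  let D := p == 0 in let E := p * r - q == 0 in let F := q == 0 in
  let G := r == 0 in let H := x * q - z == 0 in
  all (has (fun L => flag_minor L (mx_unip x y z p q r) == 0)) chart_triples
  = [&& [|| A, B | C], [|| B, C | D], [|| B, D | E], [|| D, E | F],
        [|| E, F | G], [|| F, G | H], [|| A, G | H] & [|| A, C | H]].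
Proof.
have [[_ mA mB _] [_ mD mF] [mC mH _] [_ mG mE _]] := flag_minor_unip x y z p q r.
by rewrite /= mA mB mC mD mE mF mG mH !orbF !andbT.
Qed.

(** The case split is on x, then on y (if x = 0) or on C = x p - y (if not); each
    branch determines the family, the non-vanishing of the frozen minors
    excluding all but one way of satisfying the triples. *)
Lemma deep_unip_families x y z p q r (u := mx_unip x y z p q r) :
  deep_unip u -> (@D1' F `|` @D2' F `|` @D3' F `|` @D4' F)%classic u.
Proof.
rewrite /deep_unip frozen_unipE triples_unipE.
have minus0 (a : F) : (0 - a == 0) = (a == 0) by rewrite sub0r oppr_eq0.
case=> /and3P[z0 p2 p3] /and5P[ABC BCD _ DEF /and4P[EFG FGH AGH ACH]].
  have [x0|x0] := eqVneq x 0.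
    rewrite {}/u; subst x; rewrite !mul0r !minus0 (negbTE z0) !orbF in BCD FGH.
    have [y0|y0] := eqVneq y 0.
      subst y; rewrite mul0r minus0 mulf_eq0 negb_or z0 /= in p2.
      have q0 : q = 0.
        apply/eqP; move: DEF; rewrite (negbTE p2) /= => /orP[] //.
        by case/orP: FGH => // /eqP ->; rewrite mulr0 minus0.
      by left; left; left; exists z, p, r; rewrite q0.
    rewrite (negbTE y0) /= in BCD; move/eqP: BCD => p0; subst p.
    rewrite mulr0 subr0 mulf_eq0 negb_or y0 /= in p2.
    rewrite mul0r minus0 orbA orbb (negbTE p2) /= in EFG; move/eqP: EFG => r0.
    by left; left; right; exists y, z, q; rewrite r0.
  rewrite (negbTE x0) /= in ABC AGH ACH.
  have [C0|C0] := eqVneq (x * p - y) 0.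
    move/eqP: C0; rewrite subr_eq0 => /eqP yE.
    (* Once y = x p, the frozen minor y q - z p factors as p (x q - z). *)
    have : p * (x * q - z) != 0.
      by apply: contraNneq p2 => E; rewrite -yE -E; apply/eqP; ring.
    rewrite mulf_eq0 negb_or => /andP[p0 /negbTE H0].
    rewrite H0 orbF in AGH; move/eqP: AGH => r0.
    rewrite (negbTE p0) r0 mulr0 minus0 orbb /= in DEF; move/eqP: DEF => q0.
    by right; exists z, p, x; rewrite {}/u -yE r0 q0.
  rewrite (negbTE C0) /= in ABC ACH; rewrite orbF in ABC.
  move/eqP: ABC => y0; move: ACH; rewrite subr_eq0 => /eqP zE.
  have q0 : q != 0 by apply: contraNneq z0 => q0; rewrite -zE q0 mulr0.
  have p0 : p != 0.
    by apply: contraNneq C0 => ->; rewrite y0 mulr0 subr0.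
  rewrite (negbTE p0) (negbTE q0) orbF /= subr_eq0 in DEF; move/eqP: DEF => qE.
  have r0 : r != 0 by apply: contraNneq q0 => r0; rewrite -qE r0 mulr0.
  left; right; exists x, p, r; split=> //.
  by rewrite /u y0 -zE -qE mulrA.
Qed.

Lemma families_deep_unip g :
  (@D1' F `|` @D2' F `|` @D3' F `|` @D4' F)%classic g ->
  exists x y z p q r, g = mx_unip x y z p q r /\ deep_unip g.
Proof.
rewrite /deep_unip.
case=> [[[|]|]|].
- case=> u [v [t [u0 v0 ->]]]; exists 0, 0, u, v, 0, t; split=> //.
  rewrite frozen_unipE triples_unipE !mul0r !sub0r opprK !oppr_eq0 mulf_eq0.
  by rewrite negb_or u0 v0 eqxx !orbT.
- case=> u [v [w [u0 v0 w0 ->]]]; exists 0, u, v, 0, w, 0; split=> //.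
  rewrite frozen_unipE triples_unipE !(mul0r, mulr0) !sub0r opprK subr0 mulf_eq0.
  by rewrite negb_or u0 v0 w0 eqxx !orbT.
- case=> u [v [w [u0 v0 w0 ->]]]; exists u, 0, (u * v * w), v, (v * w), w.
  split=> //; rewrite frozen_unipE triples_unipE !mulrA !mul0r subrr mulr0 !sub0r.
  rewrite subrr opprK !oppr_eq0.
  by rewrite !mulf_eq0 !negb_or u0 v0 w0 eqxx !orbT.
- case=> u [v [t [u0 v0 ->]]]; exists t, (t * v), u, v, 0, 0; split=> //.
  rewrite frozen_unipE triples_unipE !mulr0 subrr mulr0 !sub0r opprK oppr_eq0.
  by rewrite subrr mulf_eq0 negb_or u0 v0 eqxx !orbT.
Qed.

End Minors.

Lemma minor_deep_locus_families (F : fieldType) :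
  @minor_deep_locus F =
  [set M : 'M[F]_4 | exists h g : 'M[F]_4,
     [/\ @torus F h, (@D1' F `|` @D2' F `|` @D3' F `|` @D4' F) g
       & M = h *m g]]%classic.
Proof.
apply/seteqP; split=> M /=.
  move=> deepM; have [[upM _] _] := deepM.
  have [h [x [y [z [p [q [r [torh EM]]]]]]]] := borel_upper_factor upM.
  exists h, (mx_unip x y z p q r); split=> //; apply: deep_unip_families.
  by apply/(deep_unipP _ _ _ _ _ _ torh); rewrite -EM.
case=> h [g [torh /families_deep_unip[x [y [z [p [q [r [-> deepg]]]]]]] ->]].
exact/(deep_unipP _ _ _ _ _ _ torh).
Qed.

Local Open Scope classical_set_scope.
Local Open Scope complex_scope.

Theorem theorem9p1 (R : realType) :
  @minor_deep_locus R[i] =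
  [set M : 'M[R[i]]_4 | exists h g : 'M[R[i]]_4,
     [/\ @torus R[i] h,
         (@D1' R[i] `|` @D2' R[i] `|` @D3' R[i] `|` @D4' R[i]) g
       & M = h *m g]].
Proof. exact: minor_deep_locus_families. Qed.
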